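(* Let $X=\{1,2\}^{\mathbb{N}}$, $J=\{1,2\}$, with the max-plus IFS $(X,\phi,q)$ given by $\phi_j(x_1,x_2,x_3,\dots)=(j,x_1,x_2,\dots)$ and $q_j(x_1,x_2,\dots)=0$ if $j=x_1$, $q_j(x_1,x_2,\dots)=-1$ if $j\ne x_1$. For $\alpha\in[0,1)$ let $\lambda_\alpha:X\to\mathbb{R}\cup\{-\infty\}$ be defined by: $\lambda_\alpha(x)=-\infty$ if $x$ has infinitely many $2$'s and infinitely many $1$'s; $\lambda_\alpha(x)=-n$ if $x$ has $n$ changes of symbols and finitely many $2$'s; $\lambda_\alpha(x)=-n-\alpha$ if $x$ has $n$ changes of symbols and finitely many $1$'s (in particular $\lambda_\alpha(1,1,1,\dots)=0$ and $\lambda_\alpha(2,2,2,\dots)=-\alpha$). Then for any $\alpha\in[0,1)$ the idempotent probability $\mu_\alpha$ on $X$ defined by $$\mu_\alpha(f)=\sup_{x\in X}\big(\lambda_\alpha(x)+f(x)\big),\qquad f\in C(X,\mathbb{R}),$$ is invariant for the operator $M_{\phi,q}$.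
   Context: $X=\{1,2\}^{\mathbb{N}}$ has the metric $d(x,y)=(1/2)^{\min\{i\,:\,x_i\ne y_i\}}$ for $x\neq y$, where $x=(x_1,x_2,\dots)$, and $J=\{1,2\}$ has the metric with $d(1,2)=1$. A change of symbols of $x$ is an index $i$ with $x_i\neq x_{i+1}$. An idempotent probability on $X$ is a functional $m:C(X,\mathbb{R})\to\mathbb{R}$ with $m(a+f)=a+m(f)$, $m(\max(f,g))=\max(m(f),m(g))$ for all $a\in\mathbb{R}$, $f,g\in C(X,\mathbb{R})$, and $m(0)=0$; $I(X)$ is the set of these. The operator $M_{\phi,q}:I(X)\to I(X)$ is $M_{\phi,q}(\mu)(f)=\max_{j\in J}\mu(q_j+f\circ\phi_j)$ for $f\in C(X,\mathbb{R})$, and $\mu$ is invariant if $M_{\phi,q}(\mu)=\mu$. Here $-\infty+a=-\infty$ for $a\in\mathbb{R}$. *)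

(* Defs.v *)
From HB Require Import structures.
From mathcomp Require Import all_boot all_order all_algebra.
From mathcomp Require Import finmap.
From mathcomp Require Import all_classical all_reals all_analysis.

Set Implicit Arguments.
Unset Strict Implicit.
Unset Printing Implicit Defensive.

Import Order.TTheory GRing.Theory Num.Theory.
Import numFieldNormedType.Exports.

Local Open Scope classical_set_scope.
Local Open Scope ring_scope.

(** ** Idempotent probabilities and the max-plus operator *)

Section continuous_operations.
Context {R : realType} {T : topologicalType}.
Implicit Types f g : continuousType T R.

Lemma cts_add_subproof f g : continuous (fun x => f x + g x : R).
Proof. by move=> x; apply: (@cvgD _ R); exact: (@cts_fun _ _ _ x). Qed.

Definition cts_add f g : continuousType T R := mkcts (@cts_add_subproof f g).

Lemma cts_max_subproof f g : continuous (fun x => Num.max (f x) (g x) : R).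
Proof. by move=> x; apply: (@continuous_max _ _ f g x); exact: (@cts_fun _ _ _ x). Qed.

Definition cts_max f g : continuousType T R := mkcts (@cts_max_subproof f g).

Definition cts_cst (a : R) : continuousType T R := cst a.

Definition cts_comp f (p : continuousType T T) : continuousType T R := f \o p.

End continuous_operations.

Record idempotent_probability {R : realType} {T : topologicalType}
    (m : continuousType T R -> R) : Prop := IdempotentProbability {
  idemp_add : forall (a : R) f, m (cts_add (cts_cst a) f) = a + m f ;
  idemp_max : forall f g, m (cts_max f g) = Num.max (m f) (m g) ;
  idemp_zero : m (cts_cst 0) = 0
}.

Variant symbol := sym1 | sym2.

Definition bool_of_symbol (s : symbol) : bool := if s is sym1 then false else true.
Definition symbol_of_bool (b : bool) : symbol := if b then sym2 else sym1.
Lemma bool_of_symbolK : cancel bool_of_symbol symbol_of_bool.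
Proof. by case. Qed.
HB.instance Definition _ := Equality.copy symbol (can_type bool_of_symbolK).
HB.instance Definition _ := Choice.copy symbol (can_type bool_of_symbolK).

Section max_plus_operator.
Context {R : realType} {T : topologicalType}.
Variables (phi : symbol -> continuousType T T).
Variables (q : symbol -> continuousType T R).
Implicit Types m : continuousType T R -> R.

Definition max_plus_operator m : continuousType T R -> R := fun f =>
  Num.max (m (cts_add (q sym1) (cts_comp f (phi sym1))))
          (m (cts_add (q sym2) (cts_comp f (phi sym2)))).

Definition invariant_functional m := max_plus_operator m = m.

(** When max_j q_j = 0, the operator maps I(X) to itself. *)
Lemma max_plus_operator_idemp m :
  (forall x, Num.max (q sym1 x) (q sym2 x) = 0) ->
  idempotent_probability m -> idempotent_probability (max_plus_operator m).
Proof.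
move=> q0 [madd mmax m0]; rewrite /max_plus_operator; split => [a f|f g|].
- have E j : cts_add (q j) (cts_comp (cts_add (cts_cst a) f) (phi j)) =
      cts_add (cts_cst a) (cts_add (q j) (cts_comp f (phi j))).
    by apply/continuousEP => x; exact: addrCA.
  by rewrite !E !madd addr_maxr.
- have E j : cts_add (q j) (cts_comp (cts_max f g) (phi j)) =
      cts_max (cts_add (q j) (cts_comp f (phi j)))
              (cts_add (q j) (cts_comp g (phi j))).
    by apply/continuousEP => x; exact: addr_maxr.
  by rewrite !E !mmax maxACA.
- rewrite -mmax -[RHS]m0; congr m.
  apply/continuousEP => x; change (Num.max (q sym1 x + 0) (q sym2 x + 0) = 0).
  by rewrite !addr0.
Qed.

End max_plus_operator.

(** ** The metric spaces J = {1,2} and X = {1,2}^N *)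

(** The metric takes values in [R], hence the parameter of the aliases. *)
Definition J (R : realType) : Type := symbol.

Section J_metric.
Context {R : realType}.
Implicit Types j k : symbol.

Definition J_dist j k : R := (j != k)%:R.

Lemma J_distxx j : J_dist j j = 0.
Proof. by rewrite /J_dist eqxx. Qed.

Lemma J_dist_eq0 j k : J_dist j k = 0 -> j = k.
Proof.
by rewrite /J_dist; case: eqP => // _ /eqP; rewrite oner_eq0.
Qed.

Lemma J_dist_sym j k : J_dist j k = J_dist k j.
Proof. by rewrite /J_dist eq_sym. Qed.

Lemma J_dist_triangle j i k : J_dist i k <= J_dist i j + J_dist j k.
Proof.
rewrite /J_dist -natrD ler_nat; case: (eqVneq i j) => [->|_]; first by [].
by rewrite (@leq_trans 1)// ?leq_b1 ?leq_addr.
Qed.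

HB.instance Definition _ := Choice.copy (J R) symbol.
HB.instance Definition _ := @isMetric.Build R (J R) J_dist
  J_distxx J_dist_eq0 J_dist_sym J_dist_triangle.

End J_metric.

(** Sequences are indexed from 0 here: [x i] is the entry x_{i+1}. *)
Definition X (R : realType) : Type := nat -> symbol.

Section X_metric.
Context {R : realType}.
Implicit Types x y z : nat -> symbol.

(** The exponent is shifted by one because indices start from 1 in
    d(x,y) = (1/2)^min{i : x_i <> y_i}. *)
Definition X_dist x y : R :=
  if pselect (exists i, x i != y i) is left xy
  then (1 / 2) ^+ (ex_minn xy).+1 else 0.

Lemma X_dist_le x y n :
  X_dist x y <= (1 / 2) ^+ n.+1 <-> (forall i, (i < n)%N -> x i = y i).
Proof.
have h0 : 0 < (1 / 2 : R) by rewrite divr_gt0.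
have h1 : (1 / 2 : R) < 1 by rewrite ltr_pdivrMr// mul1r ltr1n.
rewrite /X_dist; case: pselect => [xy|xy].
  case: ex_minnP => m xym minm; rewrite ler_iXn2l// ltnS; split.
    move=> nm i ilt; apply/eqP/negPn/negP => /minm.
    by rewrite leqNgt (leq_trans ilt nm).
  by move=> E; rewrite leqNgt; apply/negP => /E/eqP; rewrite (negbTE xym).
split => [_ i _|_]; last by rewrite exprn_ge0// ltW.
by apply/eqP/negPn/negP => xyi; apply: xy; exists i.
Qed.

Lemma X_distP x y : X_dist x y = 0 \/
  exists n, X_dist x y = (1 / 2) ^+ n.+1.
Proof. by rewrite /X_dist; case: pselect => [xy|_]; [right; eexists|left]. Qed.

Lemma X_dist_ge0 x y : 0 <= X_dist x y.
Proof.
by case: (X_distP x y) => [->//|[n ->]]; rewrite exprn_ge0// divr_ge0.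
Qed.

Lemma X_distxx x : X_dist x x = 0.
Proof. by rewrite /X_dist; case: pselect => // e; exfalso; case: e => i; rewrite eqxx. Qed.

Lemma X_dist_eq0 x y : X_dist x y = 0 -> x = y.
Proof.
move=> xy0; apply/funext => i; apply: ((X_dist_le x y i.+1).1 _ i (ltnSn i)).
by rewrite xy0 exprn_ge0// divr_ge0.
Qed.

Lemma X_dist_sym x y : X_dist x y = X_dist y x.
Proof.
wlog: x y / X_dist y x < X_dist x y.
  by move=> W; case: (ltgtP (X_dist x y) (X_dist y x)) => // /W // ->.
case: (X_distP y x) => [/X_dist_eq0 ->//|[n e]]; rewrite e ltNge => /negP[].
by apply/X_dist_le => i ilt; apply/esym; move: i ilt; apply/X_dist_le; rewrite e.
Qed.

Lemma X_dist_ultra y x z : X_dist x z <= Num.max (X_dist x y) (X_dist y z).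
Proof.
have [/X_dist_eq0 <-|[n xy]] := X_distP x y; first by rewrite le_max lexx orbT.
have [/X_dist_eq0 <-|[p yz]] := X_distP y z; first by rewrite le_max lexx.
have [r [Er xyr yzr]] : exists r, [/\ Num.max (X_dist x y) (X_dist y z) =
    (1 / 2) ^+ r.+1, X_dist x y <= (1 / 2) ^+ r.+1
    & X_dist y z <= (1 / 2) ^+ r.+1].
  case: (leP (X_dist x y) (X_dist y z)) => H.
    by exists p; rewrite -yz.
  by exists n; rewrite -xy; split=> //; exact: ltW.
rewrite Er; apply/X_dist_le => i ir.
by rewrite ((X_dist_le x y r).1 xyr i ir) ((X_dist_le y z r).1 yzr i ir).
Qed.

Lemma X_dist_triangle y x z : X_dist x z <= X_dist x y + X_dist y z.
Proof.
apply: le_trans (X_dist_ultra y x z) _.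
by rewrite ge_max lerDl lerDr !X_dist_ge0.
Qed.

HB.instance Definition _ := gen_eqMixin (X R).
HB.instance Definition _ := gen_choiceMixin (X R).
HB.instance Definition _ := @isMetric.Build R (X R) X_dist
  X_distxx X_dist_eq0 X_dist_sym X_dist_triangle.

End X_metric.

(** ** The max-plus IFS *)

Section example_ifs.
Context {R : realType}.
Implicit Types (j k : symbol) (x y : X R).

Definition phi_map j x : X R := fun i => if i is i'.+1 then x i' else j.

Lemma phi_map_contraction j k x y :
  mdist (phi_map j x) (phi_map k y) <=
  1 / 2 * Num.max (mdist (j : J R) (k : J R)) (mdist x y).
Proof.
have h2 : 0 <= (1 / 2 : R) by rewrite divr_ge0.
change (X_dist (phi_map j x) (phi_map k y) <=
  1 / 2 * Num.max (J_dist j k) (X_dist x y) :> R).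
have [->|jk] := eqVneq j k.
  rewrite J_distxx (max_idPr _) ?X_dist_ge0//.
  have [xy0|[n xyn]] := X_distP (R := R) x y.
    by rewrite (X_dist_eq0 xy0) !X_distxx mulr0.
  rewrite xyn -exprS; apply/X_dist_le => -[|i]//=; rewrite ltnS.
  by move: i; apply: (X_dist_le (R := R) x y n).1; rewrite xyn.
apply: (@le_trans _ _ (1 / 2 * 1)); last first.
  by rewrite ler_wpM2l// /J_dist jk le_max lexx.
by rewrite mulr1 -[X in _ <= X]expr1; apply/X_dist_le.
Qed.

Lemma phi_continuous j : continuous (phi_map j : X R -> X R).
Proof.
move=> x.
apply/(@metricType_numDomainType.cvgrPdist_lt R (X R) (X R) _ (nbhs_filter x)).
move=> e e0; near=> y.
apply: le_lt_trans (phi_map_contraction j j x y) _.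
rewrite mdistxx (max_idPr (mdist_ge0 _ _)).
have yx : mdist x y < e by near: y; exact: metricType_numDomainType.cvgr_dist_lt.
by rewrite mul1r (le_lt_trans _ yx)// ler_piMl ?mdist_ge0// invf_le1// ler1n.
Unshelve. all: by end_near. Qed.

Definition phi j : continuousType (X R) (X R) := mkcts (@phi_continuous j).

Definition q_map j x : R := if j == x 0%N then 0 else -1.

Lemma q_continuous j : continuous (q_map j : X R -> R).
Proof.
move=> x; apply: (@cvg_near_cst _ R (q_map j x) (q_map j) (nbhs x) (nbhs_filter x)).
near=> y.
have yx : mdist x y < (1 / 2) ^+ 1.
  by near: y; apply: metricType_numDomainType.cvgr_dist_lt; rewrite // divr_gt0.
suff -> : q_map j y = q_map j x by [].
rewrite /q_map; suff -> : y 0%N = x 0%N by [].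
apply/esym/eqP/negPn/negP => xy0; move: yx; rewrite ltNge => /negP; apply.
change ((1 / 2) ^+ 1 <= X_dist x y :> R); rewrite /X_dist.
case: pselect => [e|[]]; last by exists 0%N.
by case: ex_minnP => -[//|m] _ /(_ _ xy0).
Unshelve. all: by end_near. Qed.

Definition q j : continuousType (X R) R := mkcts (@q_continuous j).

Lemma q_normalized x : Num.max (q sym1 x) (q sym2 x) = 0.
Proof.
change (Num.max (q_map sym1 x) (q_map sym2 x) = 0); rewrite /q_map.
by case: (x 0%N); [apply: max_l | apply: max_r]; exact: lerN10.
Qed.

End example_ifs.

(** ** The density lambda_alpha and the functional mu_alpha *)

Section lambda_mu.
Context {R : realType}.
Implicit Types (x : X R) (alpha : R).

Definition occurrences (s : symbol) x : set nat := [set i | x i = s].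

Definition changes x : set nat := [set i | x i <> x i.+1].

(** Only meaningful when [changes x] is finite. *)
Definition nb_changes x : nat := #|` fset_set (changes x)|%fset.

Definition lambda alpha x : \bar R :=
  if `[< infinite_set (occurrences sym2 x) /\
         infinite_set (occurrences sym1 x) >] then -oo%E
  else if `[< finite_set (occurrences sym2 x) >]
  then (- (nb_changes x)%:R)%:E
  else (- (nb_changes x)%:R - alpha)%:E.

Definition mu_sup alpha (f : continuousType (X R) R) : \bar R :=
  ereal_sup [set lambda alpha x + (f x)%:E | x in [set: X R]]%E.

(** [fine] sends an infinite supremum to 0, so finiteness of [mu_sup alpha f]
    has to be asserted separately. *)
Definition mu alpha (f : continuousType (X R) R) : R := fine (mu_sup alpha f).

End lambda_mu.

(* Main.v *)
Require Import Defs.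
From mathcomp Require Import all_boot all_order all_algebra.
From mathcomp Require Import finmap.
From mathcomp Require Import all_classical all_reals all_analysis.

Set Implicit Arguments.
Unset Strict Implicit.
Unset Printing Implicit Defensive.

Import Order.TTheory GRing.Theory Num.Theory.
Import numFieldNormedType.Exports.

Local Open Scope ring_scope.

(** Prepending [j] to [x] creates one new change of symbols when [j] differs
    from the first entry of [x], and none otherwise, while the tail behaviour is
    unchanged; hence the cocycle identity
    lambda (phi_j x) = lambda x + q_j x ([lambda_phi]).
    Every sequence is phi_j x for its first entry j and its shift x, so taking
    the supremum of lambda (phi_j x) + f (phi_j x) over j and x is taking the
    supremum of lambda + f over the whole space: this is invariance.

    The suprema are real numbers: lambda <= 0 with equality at 111..., and a
    continuous function is bounded above on the sequence space
    ([continuous_bounded_above]).  It follows that mu f is the real number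
    characterized by: mu f <= r iff lambda x + f x <= r for all x ([mu_le]).
    The axioms of an idempotent probability and invariance are then compared
    through their upper bounds r, where each is a pointwise statement. *)

Lemma eq_from_upper_bounds (R : realType) (a b : R) :
  (forall r, a <= r <-> b <= r) -> a = b.
Proof. by move=> ab; apply/le_anti; rewrite (ab b).2 ?(ab a).1. Qed.

(** * Continuous functions on the sequence space are bounded above *)

Section bounded_above.
Context {R : realType}.
Implicit Types (f g : X R -> R) (x y : X R) (j : symbol).

Definition shift x : X R := fun i => x i.+1.

Lemma phi_map_shift x : phi_map (x 0%N) (shift x) = x.
Proof. by apply/funext => -[]. Qed.

Definition bounded_above g := exists M, forall x, g x <= M.

Definition bad_symbol g : symbol :=
  if `[< bounded_above (g \o phi_map sym1) >] then sym2 else sym1.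

(** The two cylinders of length 1 cover the space, so bounds on both would give
    a bound everywhere. *)
Lemma bad_symbolP g : ~ bounded_above g ->
  ~ bounded_above (g \o phi_map (bad_symbol g)).
Proof.
rewrite /bad_symbol; case: asboolP => // -[M1 g1] gu [M2 g2]; apply: gu.
exists (Num.max M1 M2) => x; rewrite le_max -(phi_map_shift x).
case: (x 0%N); first by rewrite (g1 (shift x)).
by rewrite (g2 (shift x)) orbT.
Qed.

(** The function [f] on the cylinder of the first [n] bad symbols, written in
    the coordinates of the whole sequence space. *)
Fixpoint bad_restriction f n : X R -> R :=
  if n is n'.+1 then
    bad_restriction f n' \o phi_map (bad_symbol (bad_restriction f n'))
  else f.

Definition bad_point f : X R := fun n => bad_symbol (bad_restriction f n).

Lemma bad_restriction_unbounded f n :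
  ~ bounded_above f -> ~ bounded_above (bad_restriction f n).
Proof. by move=> fu; elim: n => // n /bad_symbolP. Qed.

(** The witness [z] is the word of the first [n] bad symbols followed by [y].
    The clause on the tail of [z] is there for the induction on [n]: it gives
    the entry of [z] at the position [n] that the step appends. *)
Lemma bad_restrictionE f n y : exists z : X R,
  [/\ forall i, (i < n)%N -> z i = bad_point f i,
      forall i, z (n + i)%N = y i & bad_restriction f n y = f z].
Proof.
elim: n y => [|n IH] y; first by exists y.
have [z [zx zy fz]] := IH (phi_map (bad_point f n) y).
exists z; split=> // i; last by rewrite addSnnS zy.
rewrite ltnS leq_eqVlt => /predU1P[->|/zx//].
by have := zy 0%N; rewrite addn0.
Qed.

(** The sequence space is compact. If [f] were unbounded above, repeatedly
    choosing a half of the current cylinder where [f] is unbounded would lead to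
    a point with no neighbourhood on which [f] is bounded above. *)
Lemma continuous_bounded_above f : continuous f -> bounded_above f.
Proof.
move=> cf; apply: contrapT => fu.
set x := bad_point f.
have near_x : \forall y \near x, f y < f x + 1.
  by apply: (cvgr_lt (f x) (cf x)); rewrite ltrDl.
have [e /= e0 ballx] := (nbhs_ballP x _).1 near_x.
have [n ne] : exists n, (1 / 2 : R) ^+ n.+1 < e.
  have [N _ Ne] := near_infty_natSinv_expn_lt (PosNum e0).
  by exists N; have := Ne N.+1 (leqnSn N); rewrite expr_div_n expr1n.
apply: (@bad_restriction_unbounded f n fu); exists (f x + 1) => y.
have [z [zx _ ->]] := bad_restrictionE f n y.
apply/ltW/ballx; rewrite ballEmdist /=.
apply: le_lt_trans ne.
by apply/(X_dist_le (R := R) x z n) => i /zx.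
Qed.

End bounded_above.

(** * The density under prepending a symbol *)

Section density.
Local Open Scope classical_set_scope.
Context {R : realType}.
Implicit Types (x : X R) (j s : symbol) (alpha : R).

Lemma finite_preimage_succ (A : set nat) :
  finite_set (succn @^-1` A) <-> finite_set A.
Proof.
split=> fA; last by apply: finite_preimage fA => i k _ _ [].
apply: (@sub_finite_set _ _ ([set 0%N] `|` succn @` (succn @^-1` A))).
  by move=> [|i] Ai; [left|right; exists i].
by rewrite finite_setU; split; [exact: finite_set1|exact: finite_image].
Qed.

Lemma finite_occurrences_phi s j x :
  finite_set (occurrences s (phi_map j x)) <-> finite_set (occurrences s x).
Proof. by rewrite -finite_preimage_succ. Qed.

(** At a change of symbols, [s] is the symbol on one side or on the other. *)
Lemma finite_changes s x : finite_set (occurrences s x) -> finite_set (changes x).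
Proof.
move=> fs; apply: (@sub_finite_set _ _
    (occurrences s x `|` succn @^-1` occurrences s x)).
  rewrite /changes /occurrences => i /=.
  by case: s {fs} (x i) (x i.+1) => -[] []; (by left) || by right.
by rewrite finite_setU; split=> //; apply/finite_preimage_succ.
Qed.

Lemma changes_phi j x : changes (phi_map j x) =
  (if j == x 0%N then set0 else [set 0%N]) `|` succn @` changes x.
Proof.
apply/seteqP; split => -[|i] /=.
- by move=> /eqP/negbTE jx; left; rewrite jx.
- by move=> xi; right; exists i.
- by case: eqVneq => [_ [//|[]//]|/eqP].
- by case: eqVneq => _ [//|[k xk [<-]]].
Qed.

Lemma nb_changes_phi j x : finite_set (changes x) ->
  nb_changes (phi_map j x) = ((j != x 0%N) + nb_changes x)%N.
Proof.
move=> fx; have fSx : finite_set (succn @` changes x) by exact: finite_image.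
have cardS : #|` fset_set (succn @` changes x)|%fset = nb_changes x.
  by rewrite fset_set_image// card_imfset//=; exact: succn_inj.
rewrite /nb_changes changes_phi; case: eqVneq => _; first by rewrite set0U.
rewrite fset_setU1// cardfsU1 cardS in_fset_set//.
by rewrite memNset// => -[].
Qed.

(** Finitely many 1's, or 2's, is a property of the tail, so both sides fall in
    the same case of the definition of the density; in the two finite cases,
    [- q_map j x] is the number of changes created at the front. *)
Lemma lambda_phi alpha j x :
  lambda alpha (phi_map j x) = (lambda alpha x + (q_map j x)%:E)%E.
Proof.
have qE : q_map j x = - (j != x 0%N)%:R.
  by rewrite /q_map; case: eqVneq; rewrite ?oppr0.
have occE s : finite_set (occurrences s (phi_map j x)) =
    finite_set (occurrences s x) by apply/propext; exact: finite_occurrences_phi.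
rewrite /lambda !occE; case: asboolP => [//|fin12].
case: asboolP => [fin2|inf2].
  rewrite (nb_changes_phi _ (finite_changes fin2)) qE natrD opprD addrC.
  by rewrite -EFinD.
have fin1 : finite_set (occurrences sym1 x) by apply: contrapT => inf1; apply: fin12.
rewrite (nb_changes_phi _ (finite_changes fin1)) qE natrD -EFinD.
by congr EFin; rewrite opprD -addrA addrC.
Qed.

Lemma lambda_le0 alpha x : 0 <= alpha -> (lambda alpha x <= 0)%E.
Proof.
move=> alpha0; rewrite /lambda; case: ifP => _; first exact: leNye.
case: ifP => _; rewrite lee_fin; first by rewrite oppr_le0.
by rewrite subr_le0 (le_trans _ alpha0)// oppr_le0.
Qed.

Lemma lambda_sym1 alpha : lambda alpha (fun=> sym1 : symbol) = 0%E.
Proof.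
have occ0 : occurrences sym2 ((fun=> sym1) : X R) = set0.
  by apply/seteqP; split.
have ch0 : changes ((fun=> sym1) : X R) = set0.
  by apply/seteqP; split=> // i /(_ erefl).
rewrite /lambda /nb_changes occ0 ch0 fset_set0 cardfs0 oppr0.
case: asboolP => [[[]]//|_].
by case: asboolP => // -[].
Qed.

End density.

(** * The functional through its upper bounds *)

Section functional.
Context {R : realType} (alpha : R).
Hypothesis alpha0 : 0 <= alpha.
Implicit Types f g : continuousType (X R) R.

(** The value of [f] at 111..., where the density vanishes, is a lower bound, and
    any upper bound of [f] is an upper bound because the density is
    nonpositive. *)
Lemma mu_sup_fin_num f : mu_sup alpha f \is a fin_num.
Proof.
have [M fM] := continuous_bounded_above (@cts_fun _ _ f).
rewrite fin_real//; apply/andP; split.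
  apply: (@lt_le_trans _ _ (f (fun=> sym1))%:E); first exact: ltNyr.
  apply: ereal_sup_ubound; exists (fun=> sym1) => //.
  by rewrite lambda_sym1 add0e.
apply: (@le_lt_trans _ _ M%:E); last exact: ltry.
apply: ge_ereal_sup => _ [x _ <-].
by rewrite -[leRHS]add0e leeD ?lambda_le0// lee_fin.
Qed.

(** Finiteness makes [fine] harmless, so that the universal property of the
    supremum descends to real bounds. *)
Lemma mu_le f r : mu alpha f <= r <->
  forall x, (lambda alpha x + (f x)%:E <= r%:E)%E.
Proof.
rewrite -lee_fin fineK ?mu_sup_fin_num//; split=> [fr x|fr].
  by apply: le_trans fr; apply: ereal_sup_ubound; exists x.
by apply: ge_ereal_sup => _ [x _ <-].
Qed.

Lemma mu_idempotent : idempotent_probability (mu alpha).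
Proof.
split=> [a f|f g|]; apply: eq_from_upper_bounds => r.
- have addE x : ((lambda alpha x + (cts_add (cts_cst a) f x)%:E <= r%:E) =
      (lambda alpha x + (f x)%:E <= (r - a)%:E))%E.
    change (cts_add (cts_cst a) f x) with (a + f x).
    by rewrite EFinD addeCA EFinB leeBrDl.
  by rewrite -lerBrDl !mu_le; split=> fr x; have := fr x; rewrite addE.
- rewrite ge_max; split.
    move/mu_le=> fgr; apply/andP; split; apply/mu_le => x;
      by apply: le_trans (fgr x); rewrite leeD2l// lee_fin le_max lexx ?orbT.
  move=> /andP[/mu_le fr /mu_le gr]; apply/mu_le => x.
  change (cts_max f g x) with (Num.max (f x) (g x)).
  by case: (leP (f x) (g x)).
- rewrite mu_le; split=> [/(_ (fun=> sym1))|r0 x].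
    by rewrite lambda_sym1 add0e lee_fin.
  by rewrite adde0 (le_trans (lambda_le0 _ alpha0)).
Qed.

(** By [lambda_phi], the branch [j] of the operator is bounded by [r] exactly
    when [lambda + f] is on the cylinder of [j], and the two cylinders cover the
    space. *)
Lemma mu_invariant : invariant_functional (@phi R) (@q R) (mu alpha).
Proof.
apply/funext => f; apply: eq_from_upper_bounds => r.
have branch j : mu alpha (cts_add (q j) (cts_comp f (phi j))) <= r <->
    forall x : X R, (lambda alpha (phi_map j x) + (f (phi_map j x))%:E <= r%:E)%E.
  rewrite mu_le; split=> fr x; have := fr x;
    change (cts_add (q j) (cts_comp f (phi j)) x)
      with (q_map j x + f (phi_map j x));
    by rewrite lambda_phi EFinD addeA.
rewrite ge_max mu_le; split.
  move=> /andP[/branch f1 /branch f2] y; rewrite -(phi_map_shift y).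
  by case: (y 0%N).
by move=> fr; apply/andP; split; apply/branch => x.
Qed.

End functional.

Theorem proposition3p1 (R : realType) (alpha : R)
    (halpha0 : 0 <= alpha) (halpha1 : alpha < 1) :
  [/\ forall f : continuousType (X R) R, mu_sup alpha f \is a fin_num,
      idempotent_probability (mu alpha) &
      invariant_functional (@phi R) (@q R) (mu alpha)].
Proof.
split; [exact: mu_sup_fin_num|exact: mu_idempotent|exact: mu_invariant].
Qed.
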